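(* Let $\mathscr{F}=\{A_1,\ldots,A_M\}$ be a finite quasi-controllable family of real $N\times N$ matrices, and suppose that the difference equation $x(n+1)=A(n)x(n)$ is Lyapunov absolutely stable with respect to $\mathscr{F}$. Then the inequality $$\chi(\mathscr{F})\le \sigma_p^{-1}(\mathscr{F})$$ holds for each $p\ge N-1$.
   Context: A finite family $\mathscr{F}$ of real $N\times N$ matrices is called quasi-controllable if no nonzero proper subspace of $\mathbb{R}^N$ is invariant for all matrices from $\mathscr{F}$. Let $\|\cdot\|$ be a fixed norm on $\mathbb{R}^N$. Quasi-controllability measure: for $k=1,2,\ldots$, $\mathscr{F}_k$ denotes the set of finite products of matrices from $\mathscr{F}\cup\{I\}$ containing no more than $k$ factors, and $\mathscr{F}_k(x)=\{Lx : L\in\mathscr{F}_k\}$ for $x\in\mathbb{R}^N$. For $W\subseteq\mathbb{R}^N$, $\operatorname{absco}(W)=\operatorname{co}(W\cup -W)$, where $\operatorname{co}$ denotes the convex hull. Let $\mathbf{S}(t)$ be the ball in $\|\cdot\|$ of radius $t$ centered at $0$. For a positive integer $p$, $$\sigma_p(\mathscr{F})=\inf_{x\in\mathbb{R}^N,\ \|x\|=1}\ \sup\{t : \mathbf{S}(t)\subseteq \operatorname{absco}[\mathscr{F}_p(x)]\},$$ and $\sigma_p^{-1}(\mathscr{F})=1/\sigma_p(\mathscr{F})$. Absolute stability and overshooting measure: the equation $x(n+1)=A(n)x(n)$, $n=0,1,2,\ldots$, is Lyapunov absolutely stable with respect to $\mathscr{F}$ if there exists $\mu<\infty$ such that for each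 sequence $A(n)\in\mathscr{F}$ any solution $x(n)$ of the corresponding equation satisfies $\sup_{n\ge 0}\|x(n)\|\le\mu\|x(0)\|$. The smallest $\mu$ for which this estimate holds (for all such sequences and solutions) is called the overshooting measure of the equation with respect to $\mathscr{F}$ and is denoted by $\chi(\mathscr{F})$. *)

(* Defs.v *)
From HB Require Import structures.
From mathcomp Require Import all_boot all_order all_algebra.
From mathcomp Require Import all_classical all_reals all_analysis.

Set Implicit Arguments.
Unset Strict Implicit.
Unset Printing Implicit Defensive.

Import Order.TTheory GRing.Theory Num.Theory.

Local Open Scope classical_set_scope.
Local Open Scope ring_scope.

(* The fixed norm on R^N is an arbitrary function [nu] with the axioms below
   (those of the factory [Lmodule_isNormed]), not the sup norm [`|x|] with which
   matrices are canonically equipped. *)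
Record is_norm (R : realType) (N : nat) (nu : 'cV[R]_N -> R) : Prop := IsNorm {
  is_norm_triangle : forall x y, nu (x + y) <= nu x + nu y;
  is_norm_scale : forall (a : R) x, nu (a *: x) = `|a| * nu x;
  is_norm_eq0 : forall x, nu x = 0 -> x = 0 }.

Definition invariant_subspace (R : realType) (N : nat) (F : set 'M[R]_N)
    (V : {vspace 'cV[R]_N}) : Prop :=
  forall L, F L -> forall v, v \in V -> L *m v \in V.

Definition quasi_controllable (R : realType) (N : nat) (F : set 'M[R]_N) : Prop :=
  ~ exists V : {vspace 'cV[R]_N},
      [/\ V != 0%VS, V != fullv & invariant_subspace F V].

Definition products (R : realType) (N : nat) (F : set 'M[R]_N) (k : nat) :
    set 'M[R]_N :=
  [set L | exists s : seq 'M[R]_N,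
     [/\ (size s <= k)%N,
         forall B, B \in s -> (F `|` [set 1%:M]) B
       & L = \big[mulmx/1%:M]_(B <- s) B]].

Definition orbit_products (R : realType) (N : nat) (F : set 'M[R]_N) (k : nat)
    (x : 'cV[R]_N) : set 'cV[R]_N :=
  [set L *m x | L in products F k].

Definition convex_hull (R : realType) (N : nat) (W : set 'cV[R]_N) :
    set 'cV[R]_N :=
  smallest (@convex_set R 'cV[R]_N) W.

Definition absco (R : realType) (N : nat) (W : set 'cV[R]_N) : set 'cV[R]_N :=
  convex_hull (W `|` [set - w | w in W]).

Definition norm_ball (R : realType) (N : nat) (nu : 'cV[R]_N -> R) (t : R) :
    set 'cV[R]_N :=
  [set y | nu y <= t].

(* For a norm [nu] and N > 0, the [sup] below is over a nonempty bounded set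
   (it contains 0, and absco of a finite set is bounded), and the [inf] is over
   a nonempty set of nonnegative reals. *)
Definition qc_measure (R : realType) (N : nat) (nu : 'cV[R]_N -> R)
    (F : set 'M[R]_N) (p : nat) : R :=
  inf [set sup [set t | norm_ball nu t `<=` absco (orbit_products F p x)]
      | x in [set x | nu x = 1]].

(* [sup_(n >= 0) nu (x n) <= mu * nu (x 0)], stated pointwise because a real
   [sup] is 0 on unbounded sets. *)
Definition overshoot_bound (R : realType) (N : nat) (nu : 'cV[R]_N -> R)
    (F : set 'M[R]_N) (mu : R) : Prop :=
  forall (A : nat -> 'M[R]_N) (x : nat -> 'cV[R]_N),
    (forall n, F (A n)) -> (forall n, x n.+1 = A n *m x n) ->
    forall n, nu (x n) <= mu * nu (x 0%N).

Definition absolutely_stable (R : realType) (N : nat) (nu : 'cV[R]_N -> R)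
    (F : set 'M[R]_N) : Prop :=
  exists mu : R, overshoot_bound nu F mu.

(* When the equation is stable, this infimum is attained:
   see [overshoot_measure_least]. *)
Definition overshoot_measure (R : realType) (N : nat) (nu : 'cV[R]_N -> R)
    (F : set 'M[R]_N) : R :=
  inf [set mu | overshoot_bound nu F mu].

Lemma is_norm_ge0 (R : realType) (N : nat) (nu : 'cV[R]_N -> R) :
  is_norm nu -> forall x, 0 <= nu x.
Proof.
move=> [tri sc _] x; have := tri x ((-1) *: x).
rewrite sc normrN1 mul1r scaleN1r subrr -(scale0r x) sc normr0 mul0r.
by rewrite -mulr2n pmulrn_lge0.
Qed.

Lemma overshoot_measure_least (R : realType) (N : nat) (nu : 'cV[R]_N -> R)
    (F : set 'M[R]_N) :
  (0 < N)%N -> is_norm nu -> F !=set0 -> absolutely_stable nu F ->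
  overshoot_bound nu F (overshoot_measure nu F) /\
  (forall mu, overshoot_bound nu F mu -> overshoot_measure nu F <= mu).
Proof.
move=> N0 nuN [B FB] stab; have nu0 := is_norm_ge0 nuN.
have lb1 : lbound [set mu | overshoot_bound nu F mu] 1.
  move=> mu mub.
  pose e : 'cV[R]_N := const_mx 1.
  have e0 : 0 < nu e.
    rewrite lt_def nu0 andbT; apply/eqP => /(is_norm_eq0 nuN)/matrixP.
    move=> /(_ (Ordinal N0) ord0) /eqP; by rewrite !mxE oner_eq0.
  have := mub (fun=> B) (fun n => iter n (mulmx B) e) (fun=> FB) (fun=> erefl) 0%N.
  by rewrite /= -[leLHS]mul1r ler_pM2r.
have inffin : has_inf [set mu | overshoot_bound nu F mu] by split; last by exists 1.
split=> [A x FA xA n|mu mub]; last by apply: ge_inf => //; case: inffin.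
have [x00|x0] := eqVneq (nu (x 0%N)) 0.
  by case: stab => mu /(_ A x FA xA n); rewrite x00 !mulr0.
have x0gt : 0 < nu (x 0%N) by rewrite lt_def x0 nu0.
rewrite -ler_pdivrMr//; apply: lb_le_inf; first by case: inffin.
by move=> mu /(_ A x FA xA n) ?; rewrite ler_pdivrMr.
Qed.

(* Main.v *)
Require Import Defs.
From mathcomp Require Import all_boot all_order all_algebra.
From mathcomp Require Import all_classical all_reals all_analysis.

Import Order.TTheory GRing.Theory Num.Theory.
Import numFieldNormedType.Exports.

Local Open Scope classical_set_scope.
Local Open Scope ring_scope.

(** Write [v x] for the supremum of [nu (P *m x)] over all finite products [P]
    of matrices of the family. Stability makes [v] finite, [nu x <= v x], and
    [v] does not increase along trajectories, hence not on the convex symmetric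
    hull of an orbit either. Therefore, if a multiple [t *: x] of a vector
    lies in [absco (F_p (L *m x))] for some product [L], then
    [`|t| * v x <= v x], so [`|t| <= 1]: after moving from [x] to [L *m x],
    the orbit hull can reach back to [x] but not beyond it
    ([orbit_absco_return]).

    A trajectory with [nu (x n) > sigma^-1 * nu (x 0)] would contradict this.
    After scaling [x n] to norm 1, the hull of its orbit contains, by the
    definition of [sigma], a ball whose radius exceeds the norm of the scaled
    [x 0]; so it contains a multiple of that vector with a factor larger than
    1 ([qc_measure_overshoot_bound]).

    It remains to see that [sigma > 0], so that its inverse means what it
    should. Quasi-controllability makes every subspace spanned by part of an
    orbit grow until it fills the space, so for [x != 0] there are [N] products
    [L_i] of length at most [N - 1] such that the [L_i *m x] form a basis
    ([orbit_basis]). Cramer's rule writes any [y] in this basis with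
    coefficients bounded by entries of an adjugate over a determinant, both
    continuous in [x]; hence the same [L_i] and the same radius of a ball inside
    the hull serve all points near [x], and compactness of the unit sphere
    gives one radius for all of them ([uniform_ball_absco]). *)

(** * Products of matrices and trajectories *)

Section Products.
Context {R : realType} {N : nat} (F : set 'M[R]_N).

Lemma products1 k : products F k 1%:M.
Proof. by exists [::]; split=> //; rewrite big_nil. Qed.

Lemma productsW k l L : (k <= l)%N -> products F k L -> products F l L.
Proof. by move=> kl [s [sk Fs ->]]; exists s; split=> //; exact: leq_trans kl. Qed.

Lemma products_mul k l L P :
  products F k L -> products F l P -> products F (k + l) (L *m P).
Proof.
move=> [s [sk Fs ->]] [t [tl Ft ->]]; exists (s ++ t).
split; first by rewrite size_cat leq_add.
  by move=> B; rewrite mem_cat => /orP[/Fs|/Ft].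
elim: s {sk Fs} => [|B s IHs] /=; first by rewrite big_nil mul1mx.
by rewrite !big_cons -IHs mulmxA.
Qed.

Lemma products_cons k B L :
  F B -> products F k L -> products F k.+1 (B *m L).
Proof.
move=> FB; apply: (@products_mul 1); exists [:: B]; split=> //.
  by move=> C; rewrite inE => /eqP->; left.
by rewrite big_cons big_nil mulmx1.
Qed.

Lemma trajectory_product (A : nat -> 'M[R]_N) (x : nat -> 'cV[R]_N) :
  (forall n, F (A n)) -> (forall n, x n.+1 = A n *m x n) ->
  forall n, exists2 L, products F n L & x n = L *m x 0%N.
Proof.
move=> FA xA; elim=> [|n [L FL xL]].
  by exists 1%:M; [exact: products1|rewrite mul1mx].
by exists (A n *m L); [exact: products_cons|rewrite xA xL mulmxA].
Qed.

(** Factors [1%:M] may occur in a product, but a trajectory need not be able to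
    stay in place; such factors are dropped, so [n] may be smaller than [k]. *)
Lemma product_trajectory k L (x0 : 'cV[R]_N) : F !=set0 -> products F k L ->
  exists (A : nat -> 'M[R]_N) (x : nat -> 'cV[R]_N) n,
    [/\ forall m, F (A m), forall m, x m.+1 = A m *m x m,
        x 0%N = x0 & x n = L *m x0].
Proof.
move=> [B0 FB0] [s [_ Fs ->]]; elim: s Fs => [|B s IHs] Fs.
  exists (fun=> B0), (fun n => iter n (mulmx B0) x0), 0%N.
  by split=> //; rewrite big_nil mul1mx.
have [|A [x [n [FA xA x00 xn]]]] := IHs.
  by move=> C sC; apply: Fs; rewrite inE sC orbT.
rewrite big_cons -mulmxA -xn.
have [|FB|->] := Fs B; first by rewrite inE eqxx.
  (* Follow the trajectory of the shorter product for [n] steps, then use [B]. *)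
  pose A' m := if (m < n)%N then A m else B.
  pose x' := fix x' m := if m is m'.+1 then A' m' *m x' m' else x0.
  have x'E m : (m <= n)%N -> x' m = x m.
    elim: m => //= m IHm mn; rewrite IHm 1?ltnW// xA /A'.
    by rewrite mn.
  exists A', x', n.+1; split=> //; last by rewrite /= x'E// /A' ltnn.
  by move=> m; rewrite /A'; case: ifP.
by exists A, x, n; split=> //; rewrite mul1mx.
Qed.

Lemma product_le_overshoot (nu : 'cV[R]_N -> R) mu k L x :
  F !=set0 -> overshoot_bound nu F mu -> products F k L ->
  nu (L *m x) <= mu * nu x.
Proof.
move=> F0 bnd FL; have [A [y [n [FA yA <- <-]]]] := product_trajectory k L x F0 FL.
exact: bnd FA yA n.
Qed.

End Products.

(** * Convex hulls *)

Section Convex.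
Context {R : realType} {N : nat}.
Implicit Types (C W : set 'cV[R]_N).

Lemma convex_setP C : @convex_set R 'cV[R]_N C <->
  forall x y t, C x -> C y -> 0 <= t -> t <= 1 -> C (t *: x + (1 - t) *: y).
Proof.
split=> [cC x y t Cx Cy t0 t1|cC x y t].
  by have /set_mem := cC x y (Itv01 t0 t1) (mem_set Cx) (mem_set Cy).
move=> /set_mem Cx /set_mem Cy; apply/mem_set.
by apply: (cC x y t%:num) => //; exact: le1.
Qed.

(** The induction needs a homogeneous form without the bound on the sum of the
    weights: a nonnegative combination of points of [C] is the total weight
    times a single point of [C]. The bound then shrinks that point towards
    [0]. *)
Lemma convex_sum C (I : Type) (s : seq I) (a : I -> R) (u : I -> 'cV[R]_N) :
  @convex_set R 'cV[R]_N C -> C 0 -> (forall i, 0 <= a i) ->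
  (forall i, C (u i)) -> \sum_(i <- s) a i <= 1 -> C (\sum_(i <- s) a i *: u i).
Proof.
move=> /convex_setP cC C0 a0 Cu.
suff [w Cw ->] : exists2 w, C w &
    \sum_(i <- s) a i *: u i = (\sum_(i <- s) a i) *: w.
  move=> s1; have := cC w 0 _ Cw C0 (sumr_ge0 _ (fun i _ => a0 i)) s1.
  by rewrite scaler0 addr0.
elim: s => [|i s [w Cw IHs]].
  by exists 0 => //; rewrite !big_nil scaler0.
rewrite !big_cons IHs; set b := \sum_(j <- s) a j.
have b0 : 0 <= b by apply: sumr_ge0.
have [ab0|ab] := eqVneq (a i + b) 0.
  exists 0 => //; rewrite scaler0.
  move/eqP: ab0; rewrite paddr_eq0// => /andP[/eqP-> /eqP->].
  by rewrite !scale0r addr0.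
have abgt : 0 < a i + b by rewrite lt_def ab addr_ge0.
exists ((a i / (a i + b)) *: u i + (1 - a i / (a i + b)) *: w).
  apply: cC => //; first by rewrite divr_ge0// ltW.
  by rewrite ler_pdivrMr// mul1r lerDl.
rewrite scalerDr !scalerA mulrBr mulr1 mulrCA divff// mulr1.
by rewrite [a i + b]addrC addrK.
Qed.

Lemma absco_sub W C : @convex_set R 'cV[R]_N C -> W `<=` C ->
  (forall w, W w -> C (- w)) -> absco W `<=` C.
Proof.
move=> cC WC WNC; apply: smallest_sub => // w [/WC//|[v Wv <-]]; exact: WNC.
Qed.

(** The signs of the [c i] are absorbed into the points, as the hull contains
    both [w i] and [- w i]. The point [v] guarantees that [W] is nonempty, which
    puts [0] into the hull even when there is no index. *)
Lemma absco_sum W (I : finType) (c : I -> R) (w : I -> 'cV[R]_N) (v : 'cV[R]_N) :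
  W v -> (forall i, W (w i)) -> \sum_i `|c i| <= 1 -> absco W (\sum_i c i *: w i).
Proof.
move=> Wv Ww c1 C [cC WC].
have CW z : W z -> C z by move=> Wz; apply: WC; left.
have CNW z : W z -> C (- z) by move=> Wz; apply: WC; right; exists z.
have C0 : C 0.
  have /convex_setP/(_ _ _ 2^-1 (CW _ Wv) (CNW _ Wv)) := cC.
  rewrite invr_ge0 ler0n invf_le1// ler1n => /(_ isT isT).
  suff -> : 1 - 2^-1 = 2^-1 :> R by rewrite scalerN subrr.
  by rewrite [X in X - _](splitr 1) mul1r addrK.
under eq_bigr => i _ do rewrite -[c i]mulr_sg_norm mulrC -scalerA.
apply: convex_sum => // i.
have [_|_|_] := sgrP (c i).
- by rewrite scale0r.
- by rewrite scale1r; exact: CW.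
- by rewrite scaleN1r; exact: CNW.
Qed.

End Convex.

(** * Norms on column vectors and the sup norm *)

Section NormTopology.
Context {R : realType} {N : nat} {nu : 'cV[R]_N -> R}.
Hypothesis nuN : is_norm nu.

Lemma is_norm0 : nu 0 = 0.
Proof. by rewrite -(scale0r 0) (is_norm_scale nuN) normr0 mul0r. Qed.

Lemma is_normN x : nu (- x) = nu x.
Proof. by rewrite -scaleN1r (is_norm_scale nuN) normrN1 mul1r. Qed.

Lemma is_norm_gt0 x : x != 0 -> 0 < nu x.
Proof.
move=> x0; rewrite lt_def (is_norm_ge0 nuN) andbT.
by apply: contra_neq x0; exact: is_norm_eq0.
Qed.

Lemma is_norm_convex_ball r : @convex_set R 'cV[R]_N [set y | nu y <= r].
Proof.
apply/convex_setP => x y t /= xr yr t0 t1.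
apply: le_trans (is_norm_triangle nuN _ _) _; rewrite !(is_norm_scale nuN).
rewrite !ger0_norm ?subr_ge0// -[leRHS](_ : t * r + (1 - t) * r = r).
  by rewrite lerD// ler_wpM2l// subr_ge0.
by rewrite mulrBl mul1r addrC subrK.
Qed.

Lemma is_norm_sum (I : Type) (s : seq I) (v : I -> 'cV[R]_N) :
  nu (\sum_(i <- s) v i) <= \sum_(i <- s) nu (v i).
Proof.
elim/big_ind2 : _ => //; first by rewrite is_norm0.
by move=> x a y b xa yb; apply: le_trans (is_norm_triangle nuN _ _) (lerD _ _).
Qed.

Lemma ler_entry_norm m n (x : 'M[R]_(m, n)) i j : `|x i j| <= `|x|.
Proof. by rewrite [leRHS]mx_normrE (le_bigmax _ (fun k => `|x k.1 k.2|) (i, j)). Qed.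

Lemma norm_trmx m n (x : 'M[R]_(m, n)) : `|x^T| = `|x|.
Proof.
suff le p q (y : 'M[R]_(p, q)) : `|y^T| <= `|y|.
  by apply/le_anti; rewrite le -{1}(trmxK x) le.
rewrite [leLHS]mx_normrE; apply/bigmax_leP; split=> // -[i j] _.
by rewrite mxE; exact: ler_entry_norm.
Qed.

Lemma is_norm_le_sup : exists2 K, 0 < K & forall x, nu x <= K * `|x|.
Proof.
exists (1 + \sum_(i < N) nu (delta_mx i 0)) => [|x].
  by rewrite ltr_wpDr// sumr_ge0// => i _; exact: is_norm_ge0.
rewrite [in nu x](matrix_sum_delta x); apply: le_trans (is_norm_sum _ _ _) _.
rewrite mulrDl mul1r mulr_suml -[leLHS]add0r lerD//; apply: ler_sum => i _.
rewrite big_ord1 (is_norm_scale nuN) mulrC ler_wpM2l ?is_norm_ge0//.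
exact: ler_entry_norm.
Qed.

(** Points are transposed here and below because the Heine-Borel theorem is
    applied to row vectors. Continuity holds as [nu] is Lipschitz for the sup
    norm. *)
Lemma is_norm_continuous_tr : continuous (fun z : 'rV[R]_N => nu z^T).
Proof.
have [K K0 nuK] := is_norm_le_sup.
have lip (y z : 'rV[R]_N) : nu y^T - nu z^T <= K * `|y - z|.
  rewrite -norm_trmx linearB lerBlDr -{1}(subrK z^T y^T).
  apply: le_trans (is_norm_triangle nuN _ _) _.
  by rewrite lerD2r nuK.
move=> z; apply/(@cvgrPdist_le _ _ _ (nbhs z) (nbhs_filter z)) => e e0; near=> y.
apply: (@le_trans _ _ (K * `|z - y|)).
  by rewrite ler_norml lerNl opprB lip distrC lip.
rewrite -ler_pdivlMl// mulrC; near: y.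
by apply: cvgr_dist_le => //; exact: divr_gt0.
Unshelve. all: by end_near. Qed.

(** Equivalence of norms: [c] is the minimum of [nu] on the compact unit sphere
    of the sup norm; it is positive as [nu] vanishes only at [0]. *)
Lemma sup_le_is_norm : (0 < N)%N ->
  exists2 c, 0 < c & forall x, c * `|x| <= nu x.
Proof.
move=> N0; pose S := [set z : 'rV[R]_N | `|z| = 1].
have S0 : S !=set0.
  exists (const_mx 1) => /=; apply/le_anti/andP; split.
    by rewrite [leLHS]mx_normrE; apply/bigmax_leP; split=> // i _; rewrite mxE normr1.
  by have := ler_entry_norm _ _ (const_mx 1 : 'rV[R]_N) 0 (Ordinal N0); rewrite mxE normr1.
have cS : compact S.
  apply: bounded_closed_compact.
    by exists 1; split=> // r r1 z /= ->; exact: ltW.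
  have /continuous_closedP := @norm_continuous R 'rV[R]_N.
  by move=> /(_ _ (@closed_eq R 1)).
have [z /set_mem zS zmin] := @compact_EVT_min _ R _ S S0 cS
  (continuous_subspaceT is_norm_continuous_tr).
exists (nu z^T) => [|x].
  apply: is_norm_gt0; apply/eqP => z0; move: zS.
  rewrite /S /= -(trmxK z) z0 trmx0 normr0 => /eqP.
  by rewrite eq_sym oner_eq0.
have [->|x0] := eqVneq x 0; first by rewrite normr0 mulr0 is_norm0.
have nx0 : 0 < `|x| by rewrite normr_gt0.
have := zmin (`|x|^-1 *: x^T); rewrite linearZ /= trmxK (is_norm_scale nuN).
rewrite normfV normr_id mulrC ler_pdivlMr//; apply; apply/mem_set => /=.
by rewrite /S /= normrZ normfV normr_id norm_trmx mulVf// gt_eqF.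
Qed.

Lemma is_norm_sphere_compact : (0 < N)%N -> compact [set z : 'rV[R]_N | nu z^T = 1].
Proof.
move=> /sup_le_is_norm[c c0 cnu]; apply: bounded_closed_compact.
  exists c^-1; split=> [|r cr]; first exact: num_real.
  move=> z /= z1; apply: le_trans (ltW cr).
  by rewrite -(ler_pM2l c0) mulfV ?gt_eqF// -z1 -norm_trmx.
by have /continuous_closedP/(_ _ (@closed_eq R 1)) := is_norm_continuous_tr.
Qed.

End NormTopology.

(** * Continuity in Cramer's rule *)

Section Cramer.
Context {R : realType}.

Lemma det_continuous (T : topologicalType) n (G : T -> 'M[R]_n) :
  (forall i j, continuous (fun x => G x i j)) -> continuous (fun x => \det (G x)).
Proof.
move=> cG; apply: continuous_big => [|s _]; first exact: add_continuous.
move=> x; apply: (@cvgM R T _ _ (fun=> _)); first exact: cvg_cst.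
by apply: continuous_big => [|i _]; [exact: mul_continuous|exact: cG].
Qed.

Lemma adj_continuous (T : topologicalType) n (G : T -> 'M[R]_n) i j :
  (forall i j, continuous (fun x => G x i j)) ->
  continuous (fun x => (\adj (G x)) i j).
Proof.
move=> cG x.
rewrite (_ : (fun x => _) = fun x => cofactor (G x) j i); last first.
  by apply/funext => y; rewrite mxE.
apply: (@cvgM R T _ _ (fun=> _)); first exact: cvg_cst.
suff cdet : continuous (fun x => \det (row' j (col' i (G x)))) by exact: cdet.
apply: det_continuous => k l.
rewrite (_ : (fun x => _) = fun x => G x (lift j k) (lift i l)); last first.
  by apply/funext => y; rewrite !mxE.
exact: cG.
Qed.

(** A bound for the inverse that is uniform near an invertible matrix: the
    quotient of the determinant by the entries of the adjugate stays away from
    [0]. It is stated without division, over any base [T]. *)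
Lemma near_adj_le_det (T : topologicalType) n (G : T -> 'M[R]_n) z :
  (forall i j, continuous (fun x => G x i j)) -> \det (G z) != 0 ->
  exists2 e, 0 < e & \forall x \near z, \det (G x) != 0 /\
    e * (\sum_i \sum_j `|(\adj (G x)) i j|) <= `|\det (G x)|.
Proof.
move=> cG dz; pose S x : R := \sum_i \sum_j `|(\adj (G x)) i j|.
have cnorm (f : T -> R) : continuous f -> continuous (fun x => `|f x|).
  by move=> cf x; apply: (@cvg_norm R R^o); exact: cf.
have cdet : continuous (fun x => `|\det (G x)|).
  by apply: cnorm; exact: det_continuous.
have cS : continuous S.
  apply: continuous_big => [|i _]; first exact: add_continuous.
  apply: continuous_big => [|j _]; first exact: add_continuous.
  by apply: cnorm; exact: adj_continuous.
have S0 x : 0 <= S x by apply: sumr_ge0 => i _; apply: sumr_ge0.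
have D0 : 0 < `|\det (G z)| by rewrite normr_gt0.
(* Near [z] the determinant keeps half of its size and [S] grows by less
   than 1. *)
exists (`|\det (G z)| / 2 / (S z + 1)).
  by rewrite !divr_gt0// ltr_pwDr.
near=> x.
have Dx : `|\det (G z)| / 2 < `|\det (G x)|.
  near: x; apply: (@cvgr_gt _ _ _ _ _ _ (cdet z)).
  by rewrite ltr_pdivrMr// ltr_pMr// ltr1n.
have Sx : S x < S z + 1.
  by near: x; apply: (@cvgr_lt _ _ _ _ _ _ (cS z)); rewrite ltrDl.
split; first by rewrite -normr_gt0; apply: lt_trans Dx; rewrite divr_gt0.
apply: le_trans (ltW Dx); rewrite -/(S x) mulrAC ler_pdivrMr ?ltr_pwDr//.
by rewrite ler_wpM2l ?divr_ge0// ltW.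
Unshelve. all: by end_near. Qed.

End Cramer.

(** * A uniform ball inside the orbit hulls *)

Section Positivity.
Context {R : realType} {N : nat} (F : set 'M[R]_N).

(** The span of the vectors found so far is neither zero nor, while there are
    fewer than [N] of them, the whole space. So it is not invariant, and some
    matrix of [F] sends one of these vectors out of it: this gives the next
    vector, at the cost of one more factor. *)
Lemma free_orbit (x : 'cV[R]_N) k : quasi_controllable F -> x != 0 -> (k < N)%N ->
  exists s : seq 'M[R]_N, [/\ size s = k.+1, forall L, L \in s -> products F k L
    & free [seq L *m x | L <- s]].
Proof.
move=> qcF x0; elim: k => [|k IHk] kN.
  exists [:: 1%:M]; split=> //; last by rewrite /= mul1mx seq1_free.
  by move=> L; rewrite inE => /eqP->; exact: products1.
have [s [sk Fs frs]] := IHk (ltnW kN).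
set X := [seq L *m x | L <- s] in frs.
have dimX : \dim <<X>>%VS = k.+1 by move: frs; rewrite /free size_map sk => /eqP.
have [B [L [FB sL LX]]] : exists B L, [/\ F B, L \in s & B *m (L *m x) \notin <<X>>%VS].
  apply: contrapT => stuck; apply: qcF; exists <<X>>%VS; split.
  - by rewrite -dimv_eq0 dimX.
  - apply: contraTneq kN => XT; rewrite -leqNgt -dimX XT dimvf.
    by rewrite /dim /= muln1.
  - move=> B FB v /(@coord_span _ _ _ (in_tuple X)) ->.
    rewrite mulmx_sumr rpred_sum// => i _; rewrite -scalemxAr rpredZ//.
    have /mapP[L sL ->] : (in_tuple X)`_i \in X by rewrite mem_nth// ltn_ord.
    by apply: contrapT => /negP LX; apply: stuck; exists B, L.
exists (B *m L :: s); split; first by rewrite /= sk.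
  move=> C; rewrite inE => /orP[/eqP->|/Fs]; last exact: productsW.
  by apply: products_cons => //; exact: Fs.
by rewrite /= free_cons -mulmxA LX.
Qed.

Definition orbit_mx (L : 'I_N -> 'M[R]_N) (x : 'cV[R]_N) : 'M[R]_N :=
  \matrix_(i, j) (L j *m x) i 0.

Lemma orbit_basis (x : 'cV[R]_N) : quasi_controllable F -> x != 0 -> (0 < N)%N ->
  exists2 L, forall i, products F (N - 1) (L i) & \det (orbit_mx L x) != 0.
Proof.
move=> qcF x0 N0; have N1 : (N - 1 < N)%N by rewrite subn1 prednK.
have [s [sN Fs frs]] := free_orbit x _ qcF x0 N1.
have {}sN : size s = N by rewrite sN subn1 prednK.
exists (fun i => nth 0 s i) => [i|]; first by apply/Fs/mem_nth; rewrite sN.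
have szX : size [seq L *m x | L <- s] == N by rewrite size_map sN.
have /freeP frX : free (Tuple szX) by [].
rewrite -unitfE -unitmxE -unitmx_tr -row_free_unit.
apply: inj_row_free => v vG; apply/rowP => j; rewrite mxE.
apply: (frX (v 0)); apply/colP => i.
have /rowP/(_ i) := vG; rewrite !mxE summxE; apply: etrans; apply: eq_bigr => l _.
by rewrite !mxE (nth_map 0) ?sN// mxE.
Qed.

(** Cramer's rule: [y] has coordinates [\adj G *m y / \det G] on the columns of
    [G = orbit_mx L x], and the hypotheses on [r] make their absolute values
    sum to at most 1. *)
Lemma orbit_mx_absco L x y p r : (forall i, products F p (L i)) ->
  \det (orbit_mx L x) != 0 ->
  r * (\sum_i \sum_j `|(\adj (orbit_mx L x)) i j|) <= `|\det (orbit_mx L x)| ->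
  `|y| <= r -> absco (orbit_products F p x) y.
Proof.
move=> FL; set G := orbit_mx L x => d0 rG yr.
pose c := (\det G)^-1 *: (\adj G *m y).
have -> : y = \sum_i c i 0 *: (L i *m x).
  transitivity (G *m c).
    by rewrite -scalemxAr mulmxA mul_mx_adj mul_scalar_mx scalerA mulVf// scale1r.
  apply/colP => i; rewrite mxE summxE; apply: eq_bigr => j _.
  by rewrite !mxE mulrC.
apply: (absco_sum _ _ _ _ x).
- by exists 1%:M; [exact: products1|rewrite mul1mx].
- by move=> i; exists (L i).
have dG : 0 < `|\det G| by rewrite normr_gt0.
rewrite -(ler_pM2l dG) mulr1; apply: le_trans rG.
rewrite !mulr_sumr; apply: ler_sum => i _.
rewrite /c mxE normrM normfV mulVKf ?gt_eqF// mxE mulr_sumr.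
apply: le_trans (ler_norm_sum _ _ _) _; apply: ler_sum => j _.
rewrite normrM mulrC ler_wpM2r//; apply: le_trans yr; exact: ler_entry_norm.
Qed.

(** Near each point of the sphere the products [L] of [orbit_basis] can be kept
    fixed, and one radius works for all neighbours; the near-covering form of
    compactness passes from this to the whole sphere. *)
Lemma uniform_ball_absco (nu : 'cV[R]_N -> R) p : (0 < N)%N -> is_norm nu ->
  quasi_controllable F -> (N - 1 <= p)%N ->
  exists2 d, 0 < d & forall x, nu x = 1 ->
    norm_ball nu d `<=` absco (orbit_products F p x).
Proof.
move=> N0 nuN qcF Np; have [c c0 cnu] := sup_le_is_norm nuN N0.
have /compact_near_coveringP cov := is_norm_sphere_compact nuN N0.
have near0 : \forall d \near 0^'+, [set z | nu z^T = 1] `<=`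
    [set z | norm_ball nu d `<=` absco (orbit_products F p z^T)].
  apply: cov => z /= z1.
  have z0 : z^T != 0.
    by apply/eqP => z0; move/eqP: z1; rewrite z0 is_norm0// eq_sym oner_eq0.
  have [L FL dL] := orbit_basis _ qcF z0 N0.
  have cG i j : continuous (fun y : 'rV[R]_N => orbit_mx L y^T i j).
    have -> : (fun y : 'rV[R]_N => orbit_mx L y^T i j) =
              fun y : 'rV[R]_N => \sum_k L j i k * y 0 k.
      by apply/funext => y; rewrite !mxE; apply: eq_bigr => k _; rewrite mxE.
    apply: continuous_big => [|k _]; first exact: add_continuous.
    move=> y; apply: (@cvgM R 'rV[R]_N (nbhs y) _ (fun=> L j i k)).
      exact: cvg_cst.
    exact: coord_continuous.
  have [e e0 nearG] := near_adj_le_det _ _ _ z cG dL.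
  near=> y d => w /= wd.
  have [dy Gy] : \det (orbit_mx L y^T) != 0 /\
      e * (\sum_i \sum_j `|(\adj (orbit_mx L y^T)) i j|) <=
        `|\det (orbit_mx L y^T)| by near: y.
  apply: (orbit_mx_absco L _ _ _ e) => //.
    by move=> i; apply: productsW (FL i).
  rewrite -(ler_pM2l c0); apply: le_trans (cnu w) _; apply: le_trans wd _.
  by near: d; apply: nbhs_right_le; rewrite mulr_gt0.
near (0 : R)^'+ => d; exists d => // x x1.
rewrite -(trmxK x); have := near near0 d; apply => //=.
by rewrite trmxK.
Unshelve. all: by end_near. Qed.

End Positivity.

(** * The overshoot estimate *)

Section Overshoot.
Context {R : realType} {N : nat} {nu : 'cV[R]_N -> R} {F : set 'M[R]_N}.
Hypothesis nuN : is_norm nu.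

(** With [v x] the supremum of [nu (P *m x)] over all products [P]: such a [P]
    applied to a point [Q *m (L *m x)] of the orbit is again a product applied
    to [x], so [nu (P *m y)] is at most [v x] for [y] in the orbit of [L *m x]
    and, by convexity, in its hull. At [y = t *: x] this gives
    [`|t| * v x <= v x], and [v x] is finite by stability and positive as
    [x != 0]. *)
Lemma orbit_absco_return k p (L : 'M[R]_N) (x : 'cV[R]_N) mu t :
  F !=set0 -> overshoot_bound nu F mu -> products F k L -> x != 0 ->
  absco (orbit_products F p (L *m x)) (t *: x) -> `|t| <= 1.
Proof.
move=> F0 bnd FL x0 tx.
pose V := [set r | exists l P, products F l P /\ r = nu (P *m x)].
have V1 : V (nu x) by exists 0%N, 1%:M; split; [exact: products1|rewrite mul1mx].
have supV : has_sup V.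
  split; first by exists (nu x).
  by exists (mu * nu x) => _ [l [P [FP ->]]]; exact: product_le_overshoot FP.
have v0 : 0 < sup V.
  by apply: lt_le_trans (is_norm_gt0 nuN x x0) _; exact: sup_upper_bound.
suff all_le l P : products F l P -> `|t| * nu (P *m x) <= sup V.
  rewrite -(ler_pM2r v0) mul1r leNgt; apply/negP => lt_v.
  have t0 : 0 < `|t| by rewrite normr_gt0; apply: contraTneq lt_v => ->;
    rewrite normr0 mul0r -leNgt ltW.
  have [_ [l [P [FP ->]]]] : exists2 r, V r & sup V / `|t| < r.
    by apply: sup_gt; [exists (nu x)|rewrite ltr_pdivrMr// mulrC].
  by rewrite ltr_pdivrMr// mulrC ltNge (all_le _ _ FP).
move=> FP.
have : absco (orbit_products F p (L *m x)) `<=` [set y | nu (P *m y) <= sup V].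
  apply: absco_sub.
  - apply/convex_setP => y z s yV zV s0 s1.
    rewrite /= mulmxDr -!scalemxAr.
    by have /convex_setP := is_norm_convex_ball nuN (sup V); apply.
  - move=> _ [Q FQ <-] /=; apply: sup_upper_bound => //.
    exists (l + (p + k))%N, (P *m (Q *m L)); split; last by rewrite !mulmxA.
    by do 2 ![apply: products_mul => //].
  - move=> _ [Q FQ <-] /=; rewrite mulmxN (is_normN nuN).
    apply: sup_upper_bound => //.
    exists (l + (p + k))%N, (P *m (Q *m L)); split; last by rewrite !mulmxA.
    by do 2 ![apply: products_mul => //].
by move=> /(_ _ tx) /=; rewrite -scalemxAr (is_norm_scale nuN).
Qed.

(** This is [orbit_absco_return] for [L = 1%:M]: a ball of radius [t > 0]
    contains [t *: x]. *)
Lemma ball_radii_bounded p (x : 'cV[R]_N) mu :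
  F !=set0 -> overshoot_bound nu F mu -> nu x = 1 ->
  ubound [set t | norm_ball nu t `<=` absco (orbit_products F p x)] 1.
Proof.
move=> F0 bnd x1 t tB.
have [t0|t0] := leP t 0; first exact: le_trans t0 _.
rewrite -(gtr0_norm t0); apply: (orbit_absco_return 0 p 1%:M x mu) => //.
- exact: products1.
- by apply: contra_eq_neq x1 => ->; rewrite (is_norm0 nuN) eq_sym oner_eq0.
- by rewrite mul1mx; apply: tB; rewrite /norm_ball /= (is_norm_scale nuN) x1 mulr1 gtr0_norm.
Qed.

(** A real [sup] or [inf] only has its expected properties on a nonempty
    suitably bounded set, which is what has to be checked here: the radii are
    bounded by [ball_radii_bounded], and the suprema are bounded below by the
    radius of [uniform_ball_absco]. *)
Lemma qc_measure_bounds p mu : (0 < N)%N -> F !=set0 ->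
  quasi_controllable F -> overshoot_bound nu F mu -> (N - 1 <= p)%N ->
  0 < qc_measure nu F p /\ forall x, nu x = 1 ->
    qc_measure nu F p <=
      sup [set t | norm_ball nu t `<=` absco (orbit_products F p x)].
Proof.
move=> N0 F0 qcF bnd Np.
have [d d0 dB] := uniform_ball_absco F nu p N0 nuN qcF Np.
have supE x : nu x = 1 ->
    d <= sup [set t | norm_ball nu t `<=` absco (orbit_products F p x)].
  move=> x1; apply: ub_le_sup; last exact: dB.
  by exists 1; exact: ball_radii_bounded bnd x1.
split.
  apply: lt_le_trans d0 _; apply: lb_le_inf => [|_ [x x1 <-]]; last exact: supE.
  pose e : 'cV[R]_N := const_mx 1.
  have e0 : 0 < nu e.
    apply: is_norm_gt0 nuN _ _; apply/eqP => /matrixP/(_ (Ordinal N0) ord0)/eqP.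
    by rewrite !mxE oner_eq0.
  apply: image_nonempty; exists ((nu e)^-1 *: e) => /=.
  by rewrite (is_norm_scale nuN) gtr0_norm ?invr_gt0// mulVf// gt_eqF.
move=> x x1; apply: ge_inf; last by exists x.
by exists d => _ [y y1 <-]; exact: supE.
Qed.

Lemma qc_measure_overshoot_bound p mu : (0 < N)%N -> F !=set0 ->
  quasi_controllable F -> overshoot_bound nu F mu -> (N - 1 <= p)%N ->
  overshoot_bound nu F (qc_measure nu F p)^-1.
Proof.
move=> N0 F0 qcF bnd Np A x FA xA n.
have [s0 s_le] := qc_measure_bounds p mu N0 F0 qcF bnd Np.
have [L FL xn] := trajectory_product F A x FA xA n.
rewrite leNgt; apply/negP => jump.
have x0 : x 0%N != 0.
  by apply: contraTneq jump => x0; rewrite xn x0 mulmx0 (is_norm0 nuN) mulr0 ltxx.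
have nx0 : 0 < nu (x 0%N) by exact: is_norm_gt0.
have nxn : 0 < nu (x n) by apply: le_lt_trans jump; rewrite mulr_ge0 ?invr_ge0 ?ltW.
(* Scale so that [x n] lands on the unit sphere. *)
pose a := (nu (x n))^-1.
have a0 : 0 < a by rewrite invr_gt0.
have yn1 : nu (a *: x n) = 1.
  by rewrite (is_norm_scale nuN) gtr0_norm// mulVf// gt_eqF.
have [t tB lt_t] : exists2 t,
    norm_ball nu t `<=` absco (orbit_products F p (a *: x n)) & nu (x 0%N) * a < t.
  apply: sup_gt.
    (* A ball of negative radius is empty. *)
    by exists (-1) => y /= y1; have := le_trans (is_norm_ge0 nuN y) y1; rewrite oppr_ge0 ler10.
  by apply: lt_le_trans (s_le _ yn1); rewrite ltr_pdivrMr// mulrC -ltr_pdivrMr// mulrC.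
have na0 : nu (a *: x 0%N) = nu (x 0%N) * a.
  by rewrite (is_norm_scale nuN) gtr0_norm// mulrC.
have na0gt : 0 < nu (a *: x 0%N) by rewrite na0 mulr_gt0.
have t0 : 0 < t by apply: lt_trans lt_t; rewrite -na0.
suff : `|t / nu (a *: x 0%N)| <= 1.
  by rewrite gtr0_norm ?divr_gt0// ler_pdivrMr// mul1r na0 leNgt lt_t.
apply: (orbit_absco_return n p L (a *: x 0%N) mu _ F0 bnd FL).
  by rewrite scaler_eq0 negb_or x0 gt_eqF.
rewrite -scalemxAr -xn; apply: tB; rewrite /norm_ball /= (is_norm_scale nuN).
by rewrite gtr0_norm ?divr_gt0// divfK// gt_eqF.
Qed.

End Overshoot.

Theorem theorem2p3 (R : realType) (N M : nat) (nu : 'cV[R]_N -> R)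
    (A : 'I_M -> 'M[R]_N) (p : nat) :
  (0 < N)%N -> (0 < M)%N -> is_norm nu ->
  quasi_controllable (range A) ->
  absolutely_stable nu (range A) ->
  (0 < p)%N -> (N - 1 <= p)%N ->
  overshoot_measure nu (range A) <= (qc_measure nu (range A) p)^-1.
Proof.
move=> N0 M0 nuN qcA stable _ Np.
have A0 : range A !=set0 by exists (A (Ordinal M0)); exists (Ordinal M0).
have [_ least] := overshoot_measure_least N0 nuN A0 stable.
have [mu bnd] := stable.
exact/least/(qc_measure_overshoot_bound nuN p mu).
Qed.
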